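(* Let $R=k[x_1,\ldots,x_n]$ be a polynomial ring over a field $k$, graded by $\deg(x_i)=\ell_i\in\mathbb Z_{>0}$. Let $M$ be a positive integer that is a multiple of each of $\ell_1,\ldots,\ell_n$, and let $R^{(M)}=\bigoplus_{j\ge0}R_{jM}$ be the $M$-th Veronese subring. Then the extension $k[R_M]\subset R^{(M)}$ is birational; equivalently, $e(k[R_M])=e(R^{(M)})$.
   Context: $k[R_M]$ is the $k$-subalgebra of $R$ generated by the graded component $R_M$; $R^{(M)}$ is a finite module over it. A birational extension of domains is one inducing an equality of fraction fields. After rescaling the grading so that $R_{jM}$ has degree $j$, $k[R_M]$ is a standard graded $k$-algebra, and $e(k[R_M])$, $e(R^{(M)})$ denote the multiplicities as finite graded $k[R_M]$-modules with respect to the rescaled grading, i.e. $(n-1)!$ times the coefficient of degree $n-1$ of the Hilbert polynomial. *)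

(* Defs.v *)
From HB Require Import structures.
From mathcomp Require Import all_boot all_order all_algebra.
From mathcomp Require Import mpoly.

Set Implicit Arguments.
Unset Strict Implicit.
Unset Printing Implicit Defensive.

Import GRing.Theory.
Local Open Scope ring_scope.

Section WeightedDegree.
Context (n : nat) (l : 'I_n -> nat).

Definition wdeg (m : 'X_{1..n}) : nat := (\sum_(i < n) m i * l i)%N.

Lemma wdeg0 : wdeg 0%MM = 0%N.
Proof. by rewrite /wdeg big1 // => i _; rewrite mnm0E mul0n. Qed.

Lemma wdegD : {morph wdeg : m1 m2 / (m1 + m2)%MM >-> (m1 + m2)%N}.
Proof.
move=> m1 m2; rewrite /wdeg -big_split /=; apply: eq_bigr => i _.
by rewrite mnmDE mulnDl.
Qed.

HB.instance Definition _ := isMeasure.Build n wdeg wdeg0 wdegD.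

End WeightedDegree.

Definition gr_comp (k : fieldType) (n : nat) (l : 'I_n -> nat) (d : nat)
  (p : {mpoly k[n]}) : Prop := p \is d.-homog for (wdeg l).

Inductive gen_subalg (k : fieldType) (A : algType k) (S : A -> Prop) :
    A -> Prop :=
| gen_incl x : S x -> gen_subalg S x
| gen_scal (c : k) : gen_subalg S c%:A
| gen_add x y : gen_subalg S x -> gen_subalg S y -> gen_subalg S (x + y)
| gen_mul x y : gen_subalg S x -> gen_subalg S y -> gen_subalg S (x * y).

Definition veronese (k : fieldType) (n : nat) (l : 'I_n -> nat) (M : nat)
    (p : {mpoly k[n]}) : Prop :=
  exists N (f : nat -> {mpoly k[n]}),
    (forall j, gr_comp l (j * M) (f j)) /\ p = \sum_(j < N) f j.

(* The fraction field of a subring A of the domain R, realised as the subfield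
   of Frac(R) that A generates. *)
Definition frac_sub (R : idomainType) (A : R -> Prop) (x : {fraction R}) :
    Prop :=
  exists a b : R,
    [/\ A a, A b, b != 0 & x = FracField.tofrac a / FracField.tofrac b].

Definition birational_ext (R : idomainType) (A B : R -> Prop) : Prop :=
  (forall a, A a -> B a) /\
  (forall x : {fraction R}, frac_sub A x <-> frac_sub B x).

Definition has_dim (k : fieldType) (V : lmodType k) (U : V -> Prop) (d : nat) :
    Prop :=
  exists e : 'I_d -> V,
    (forall c : 'I_d -> k, \sum_i c i *: e i = 0 -> forall i, c i = 0) /\
    (forall u, U u <-> exists c : 'I_d -> k, u = \sum_i c i *: e i).

Definition hilbert_poly (k : fieldType) (V : lmodType k)
    (G : nat -> V -> Prop) (P : {poly rat}) : Prop :=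
  exists j0, forall j, (j0 <= j)%N -> exists2 d, has_dim (G j) d & P.[j%:R] = d%:R.

(* [has_mult n G e] includes the existence of the Hilbert polynomial, so it
   cannot hold vacuously; [has_mult_inj] shows that it determines [e].
   The usual convention applies for n > 0; at n = 0, n.-1 is 0. *)
Definition has_mult (k : fieldType) (V : lmodType k) (n : nat)
    (G : nat -> V -> Prop) (e : rat) : Prop :=
  exists2 P, hilbert_poly G P & e = (n.-1)`!%:R * P`_n.-1.

(* With A a subset of R, its degree-j piece for the grading of R^(M) in which
   R_(jM) has degree j. *)
Definition rescaled (k : fieldType) (n : nat) (l : 'I_n -> nat) (M : nat)
    (A : {mpoly k[n]} -> Prop) (j : nat) (p : {mpoly k[n]}) : Prop :=
  A p /\ gr_comp l (j * M) p.

Lemma has_dim_le (k : fieldType) (V : lmodType k) (U : V -> Prop) d d' :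
  has_dim U d -> has_dim U d' -> (d <= d')%N.
Proof.
move=> [e [fe he]] [e' [_ he']].
have Ue i : U (e i).
  apply/he; exists (fun j => (j == i)%:R).
  rewrite (bigD1 i) //= eqxx scale1r big1 ?addr0 // => j /negbTE ->.
  by rewrite scale0r.
have [C hC] : exists C : 'M[k]_(d, d'), forall i, e i = \sum_j C i j *: e' j.
  have /fin_all_exists [c hc] : forall i, exists c : {ffun 'I_d' -> k},
      e i = \sum_j c j *: e' j.
    move=> i; have [c ->] := (he' _).1 (Ue i).
    by exists (finfun c); apply: eq_bigr => j _; rewrite ffunE.
  exists (\matrix_(i, j) c i j) => i; rewrite hc.
  by apply: eq_bigr => j _; rewrite mxE.
suff /eqP <- : row_free C by exact: rank_leq_col.
rewrite -kermx_eq0; apply/eqP.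
apply/row_matrixP => r; rewrite row0; apply/rowP => i; rewrite [RHS]mxE.
set u := row r _; have uC : u *m C = 0 by rewrite /u -row_mul mulmx_ker row0.
apply: (fe (fun i => u 0 i)).
transitivity (\sum_j (u *m C) 0 j *: e' j); last first.
  by rewrite uC big1 // => j _; rewrite mxE scale0r.
under eq_bigr do rewrite hC scaler_sumr.
rewrite exchange_big /=; apply: eq_bigr => j _; rewrite mxE scaler_suml.
by apply: eq_bigr => m _; rewrite scalerA.
Qed.

Lemma has_mult_inj (k : fieldType) (V : lmodType k) n (G : nat -> V -> Prop)
    e e' :
  has_mult n G e -> has_mult n G e' -> e = e'.
Proof.
move=> [P [j0 hP] ->] [Q [j1 hQ] ->]; suff -> : P = Q by [].
apply/eqP; rewrite -subr_eq0; apply/negPn/negP => nz.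
set s := [seq (maxn j0 j1 + i)%:R : rat | i <- iota 0 (size (P - Q)%R)].
suff: (size s < size (P - Q)%R)%N by rewrite size_map size_iota ltnn.
apply: max_poly_roots => //.
  apply/allP => _ /mapP [i _ ->]; rewrite /root hornerD hornerN subr_eq0.
  have [d hd ->] := hP (maxn j0 j1 + i)%N (leq_trans (leq_maxl _ _) (leq_addr _ _)).
  have [d' hd' ->] := hQ (maxn j0 j1 + i)%N (leq_trans (leq_maxr _ _) (leq_addr _ _)).
  suff -> : d = d' by [].
  by apply/eqP; rewrite eqn_leq (has_dim_le hd hd') (has_dim_le hd' hd).
rewrite map_inj_uniq ?iota_uniq // => i i' /eqP.
by rewrite Num.Theory.eqr_nat eqn_add2l => /eqP.
Qed.

(* Main.v *)
Require Import Defs.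
From mathcomp Require Import all_boot all_order all_algebra.
From mathcomp Require Import mpoly.
From mathcomp Require Import zify ring.

Set Implicit Arguments.
Unset Strict Implicit.
Unset Printing Implicit Defensive.

Import GRing.Theory Num.Theory.

(** Both algebras are spanned by monomials: R^(M) by the x^m with M dividing the
    weight of m, and k[R_M] by the x^m with m in the monoid S generated by the
    exponents of weight M.  So both claims are claims about exponents.

    Birationality says that S and the exponents of weight divisible by M
    generate the same group.  Subtracting a multiple of one exponent
    (M / l_i) e_i, this reduces to the claim that every integer vector z with
    sum_i z_i l_i = 0 is a difference of two elements of S.  With
    g_ij = gcd(l_i, l_j), the pairwise syzygy
    p_ij = (l_j / g_ij) e_i - (l_i / g_ij) e_j is such a difference: since
    lcm(l_i, l_j) divides M, a part of x_i^(M / l_i) can be exchanged for a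
    power of x_j without changing the weight M.  The identity
    l_j z = sum_i z_i g_ij p_ij ([syzygy_expansion]) and a Bezout relation for
    the gcd of all the l_j then express z through the p_ij
    ([weight0_differences]).

    For the multiplicities, let N v be the free monoid spanned by the vectors
    (M / l_i) e_i, all of weight M.  Both exponent sets are finite unions of
    translates s + N v.  Two translates are disjoint unless their origins are
    congruent modulo the M / l_i, and otherwise they meet in the translate at
    the lcm of the origins.  The degree j part of one translate is counted by
    a binomial coefficient, polynomial in j with leading coefficient
    1 / (n-1)! if n > 0.  By inclusion-exclusion, a finite union is counted by a
    polynomial for large j, with coefficient c / (n-1)! in degree n-1, where c
    is the number of congruence classes that the union meets
    ([counting_poly_cones]).  Birationality makes this number the same for the
    two sets: if t has weight divisible by M and t + b is in S with b in S,
    then t + M b is in S and lies in the class of t ([residue_generators]). *)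

Lemma size_undup_constant (T : eqType) (r : T) (s : seq T) :
  all (pred1 r) s -> size (undup s) = (s != [::]).
Proof.
elim: s => //= x s IH /andP[/eqP -> rs]; have := IH rs.
by case: s rs {IH} => [|y s] //= /andP[/eqP -> _]; rewrite inE eqxx.
Qed.

Lemma size_degree_monomials n d : 0 < n ->
  size [seq s2m u | u : d.-tuple 'I_n <- enum (basis n d)] = 'C(d + n.-1, n.-1).
Proof. by case: n => // p _; rewrite size_basis -bin_sub ?leq_addr // addKn. Qed.

(** * Exponents of weight divisible by M *)

Section VeroneseMonoid.
Variables (n : nat) (l : 'I_n -> nat) (M : nat).
Hypotheses (l_gt0 : forall i, 0 < l i) (M_gt0 : 0 < M).
Hypothesis l_dvd_M : forall i, l i %| M.
Implicit Types (m s t : 'X_{1..n}) (L : seq 'X_{1..n}).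

Let w := wdeg l.

(** The variable x_i raised to the power [step i] has weight M. *)
Definition step i := M %/ l i.

Lemma stepM i : step i * l i = M.
Proof. by rewrite divnK. Qed.

Lemma step_gt0 i : 0 < step i.
Proof. by rewrite divn_gt0 // dvdn_leq. Qed.

Lemma step_dvd i : step i %| M.
Proof. by rewrite -[X in _ %| X](stepM i) dvdn_mulr. Qed.

Lemma wdegMn m c : w (m *+ c)%MM = w m * c.
Proof.
by rewrite /w /wdeg big_distrl; apply: eq_bigr => i _; rewrite mulmnE mulnAC.
Qed.

Lemma wdegU i : w U_(i)%MM = l i.
Proof.
rewrite /w /wdeg (bigD1 i) //= mnm1E eqxx mul1n big1 ?addn0 // => j ne.
by rewrite mnm1E eq_sym (negbTE ne).
Qed.

Lemma mdeg_le_wdeg m : mdeg m <= w m.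
Proof. by rewrite mdegE leq_sum // => i _; apply: leq_pmulr. Qed.

Definition weightM_monoid (S : 'X_{1..n} -> Prop) :=
  [/\ S 0%MM, forall a b, S a -> S b -> S (a + b)%MM & forall a, w a = M -> S a].

(** * The group generated by the exponents of weight M *)

Section Lattice.
Variable S : 'X_{1..n} -> Prop.
Hypothesis monS : weightM_monoid S.

Local Open Scope ring_scope.

(** The group generated by S, as a lattice of integer vectors. *)
Definition differences (z : 'rV[int]_n) :=
  exists a b, [/\ S a, S b & forall i, z 0 i = (a i)%:Z - (b i)%:Z].

Lemma differences0 : differences 0.
Proof. by case: monS => S0 _ _; exists 0%MM, 0%MM; split=> // i; rewrite mxE subrr. Qed.

Lemma differencesD y z : differences y -> differences z -> differences (y + z).
Proof.
case: monS => _ SD _ [a [b [Sa Sb ey]]] [c [d [Sc Sd ez]]].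
exists (a + c)%MM, (b + d)%MM; split; [exact: SD | exact: SD | move=> i].
by rewrite mxE ey ez !mnmDE; lia.
Qed.

Lemma differencesN z : differences z -> differences (- z).
Proof. by move=> [a [b [Sa Sb e]]]; exists b, a; split=> // i; rewrite mxE e; lia. Qed.

Lemma differencesZ (c : int) z : differences z -> differences (c *: z).
Proof.
move=> dz; have nat_case k : differences (k%:Z *: z).
  elim: k => [|k IH]; first by rewrite scale0r; apply: differences0.
  by rewrite intS scalerDl scale1r; apply: differencesD.
by case: (intP c) => [|k|k]; rewrite ?scaleNr; do ?apply: differencesN; apply: nat_case.
Qed.

Lemma differences_sum (I : Type) (r : seq I) (z : I -> 'rV[int]_n) :
  (forall i, differences (z i)) -> differences (\sum_(i <- r) z i).
Proof.
by move=> dz; apply: big_ind => //; [apply: differences0 | apply: differencesD].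
Qed.

Lemma differences_weightM a : w a = M -> differences (\row_i (a i)%:Z).
Proof.
case: monS => S0 _ SM wa; exists a, 0%MM; split=> //; first exact: SM.
by move=> i; rewrite mxE mnm0E subr0.
Qed.

(** The primitive relation between the two weights [l i] and [l j]. *)
Definition syzygy i j : 'rV[int]_n :=
  (l j %/ gcdn (l i) (l j))%:Z *: delta_mx 0 i
  - (l i %/ gcdn (l i) (l j))%:Z *: delta_mx 0 j.

(** Exchanging x_i^(l j / g) for x_j^(l i / g) in the monomial
    x_i^(step i) of weight M keeps the weight; x_i^(step i) contains enough
    factors x_i because (l j / g) * l i is the lcm of the two weights, which
    divides M. *)
Lemma syzygy_differences i j : differences (syzygy i j).
Proof.
case: monS => _ _ SM; set g := gcdn (l i) (l j).
have ei : (l i %/ g * g = l i)%N by rewrite divnK ?dvdn_gcdl.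
have ej : (l j %/ g * g = l j)%N by rewrite divnK ?dvdn_gcdr.
have eij : (l j %/ g * l i = l i %/ g * l j)%N.
  by rewrite -{1}ei -[in RHS]ej; lia.
have le : (l j %/ g <= step i)%N.
  rewrite -(leq_pmul2r (l_gt0 i)) stepM; apply: dvdn_leq => //.
  have -> : (l j %/ g * l i)%N = lcmn (l i) (l j).
    by rewrite divn_mulAC ?dvdn_gcdr // mulnC.
  by rewrite dvdn_lcm !l_dvd_M.
exists (U_(i) *+ step i)%MM, (U_(i) *+ (step i - l j %/ g) + U_(j) *+ (l i %/ g))%MM.
split.
- by apply: SM; rewrite wdegMn wdegU mulnC stepM.
- apply: SM; rewrite /w wdegD -/w !wdegMn !wdegU mulnBr -/(w _).
  rewrite [(l i * step i)%N]mulnC stepM mulnC [in X in (_ + X)%N]mulnC -eij.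
  by rewrite subnK // -(stepM i) leq_mul2r le orbT.
move=> k; rewrite !mxE /= mnmDE !mulmnE !mnm1E [k == i]eq_sym [k == j]eq_sym.
move: (l j %/ g)%N (l i %/ g)%N le => p q le.
by case: (i == k); case: (j == k); rewrite ?mulr1 ?mulr0 ?mul1n ?mul0n; lia.
Qed.

(** On coordinate k the sum is [z_k * l j - (k == j) * \sum_i z_i l_i]: it is
    the Koszul relation between z and the weights.  The factor gcd(l i, l j)
    is what makes the Bezout argument of [weight0_differences] work, since the
    gcd of all the weights divides it. *)
Lemma syzygy_expansion (z : 'rV[int]_n) j :
  \sum_i z 0 i * (l i)%:Z = 0 ->
  (l j)%:Z *: z = \sum_i (z 0 i * (gcdn (l i) (l j))%:Z) *: syzygy i j.
Proof.
move=> z0; apply/rowP=> k; rewrite summxE !mxE.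
transitivity (\sum_i ((l j)%:Z * z 0 i * (k == i)%:R
                       - (k == j)%:R * (z 0 i * (l i)%:Z))).
  rewrite sumrB -mulr_sumr z0 mulr0 subr0 (bigD1 k) //= eqxx mulr1 big1 ?addr0 //.
  by move=> i ne; rewrite eq_sym (negbTE ne) mulr0.
apply: eq_bigr => i _; rewrite !mxE eqxx /=.
have ei : ((gcdn (l i) (l j))%:Z * (l i %/ gcdn (l i) (l j))%:Z = (l i)%:Z).
  by rewrite -PoszM mulnC divnK ?dvdn_gcdl.
have ej : ((gcdn (l i) (l j))%:Z * (l j %/ gcdn (l i) (l j))%:Z = (l j)%:Z).
  by rewrite -PoszM mulnC divnK ?dvdn_gcdr.
by rewrite -[X in X * z 0 i]ej -[X in z 0 i * X]ei; ring.
Qed.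

(** For a fixed z, the integers h such that h z is g times a difference form
    an ideal, where g is the gcd of all the weights.  By [syzygy_expansion]
    each weight is in it, hence so is g, and g can be cancelled. *)
Lemma weight0_differences (z : 'rV[int]_n) :
  \sum_i z 0 i * (l i)%:Z = 0 -> differences z.
Proof.
move=> z0; case: (posnP n) => [n0|n_gt0].
  have -> : z = 0.
    by apply/rowP=> i; have := ltn_ord i; rewrite [X in (_ < X)%N]n0.
  exact: differences0.
pose g := \big[gcdn/0%N]_i l i.
have g_gt0 : (0 < g)%N.
  by apply: dvdn_gt0 (l_gt0 (Ordinal n_gt0)) _; apply: biggcdn_inf (dvdnn _).
suff [y dy e] : exists2 y, differences y & g%:Z *: z = g%:Z *: y.
  suff -> : z = y by [].
  apply/rowP=> i; have /rowP/(_ i) := e; rewrite !mxE; apply: mulfI.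
  by rewrite eqz_nat -lt0n.
pose K (h : nat) := exists2 y, differences y & h%:Z *: z = g%:Z *: y.
suff: K g by [].
apply: (big_ind K) => [|a b [ya da ea] [yb db eb]|j _].
- by exists 0; rewrite ?scale0r ?scaler0 //; apply: differences0.
- have [u [v e]] := Bezoutz a b.
  exists (u *: ya + v *: yb); first by apply: differencesD; apply: differencesZ.
  rewrite /gcdz /= in e.
  by rewrite -e scalerDl -!scalerA ea eb scalerDr !scalerA ![_ * g%:Z]mulrC.
exists (\sum_i (z 0 i * (gcdn (l i) (l j) %/ g)%:Z) *: syzygy i j).
  by apply: differences_sum => i; apply/differencesZ/syzygy_differences.
rewrite (syzygy_expansion j z0) scaler_sumr; apply: eq_bigr => i _.
rewrite scalerA mulrCA -PoszM muln_divA ?mulKn //.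
by rewrite dvdn_gcd; apply/andP; split; apply: biggcdn_inf (dvdnn _).
Qed.

(** This is birationality for one monomial: x^m is the quotient of x^(m + b)
    by x^b. *)
Lemma exists_denominator m : (M %| w m)%N -> exists2 b, S b & S (m + b)%MM.
Proof.
have [S0 SD SM] := monS; case: (posnP n) => [n0 _|n_gt0 /dvdnP[t wm]].
  exists 0%MM => //; have -> // : (m + 0)%MM = 0%MM.
  by apply/mnmP=> i; have := ltn_ord i; rewrite [X in (_ < X)%N]n0.
pose i0 := Ordinal n_gt0; pose v := (U_(i0) *+ step i0)%MM.
have wv : w v = M by rewrite wdegMn wdegU mulnC stepM.
pose x : 'rV[int]_n := \row_i (m i)%:Z; pose y : 'rV[int]_n := \row_i (v i)%:Z.
have row_weight (a : 'X_{1..n}) :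
    \sum_i ((\row_k (a k)%:Z) : 'rV[int]_n) 0 i * (l i)%:Z = (w a)%:Z.
  rewrite /w /wdeg -natz natr_sum; apply: eq_bigr => i _.
  by rewrite mxE natz PoszM.
(* x - t y has weight zero, and y is itself of weight M *)
have: differences (x - t%:Z *: y + t%:Z *: y).
  apply: differencesD; last exact/differencesZ/differences_weightM.
  apply: weight0_differences.
  under eq_bigr do rewrite mxE mulrDl [(- _ : 'rV_n) _ _]mxE
    [(_ *: _ : 'rV_n) _ _]mxE mulNr -mulrA.
  by rewrite sumrB -mulr_sumr !row_weight wm wv PoszM subrr.
rewrite subrK => -[a [b [Sa Sb e]]]; exists b => //.
suff -> : (m + b)%MM = a by [].
by apply/mnmP=> i; have := e i; rewrite mnmDE mxE; lia.
Qed.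

Lemma common_denominator L :
  all (fun m => M %| w m)%N L -> exists2 b, S b & forall m, m \in L -> S (m + b)%MM.
Proof.
have [S0 SD SM] := monS; elim: L => [|m L IH] /=; first by exists 0%MM.
case/andP=> /exists_denominator[b Sb Smb] /IH[c Sc Lc].
exists (b + c)%MM; first exact: SD.
move=> m'; rewrite inE => /predU1P[->|/Lc Sm']; first by rewrite addmA; apply: SD.
by rewrite [(b + c)%MM]addmC addmA; apply: SD.
Qed.

End Lattice.

(** * Translates of the free monoid and their counting polynomials *)

(** The translate s + N v, where v runs over the exponents of the
    x_i^(step i); see [in_coneP]. *)
Definition in_cone s m := [forall i, (s i <= m i) && (m i == s i %[mod step i])].
Definition cones L m := has (in_cone^~ m) L.
Definition residue m : 'X_{1..n} := [multinom m i %% step i | i < n].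

Lemma in_coneP s m :
  reflect (exists q : 'X_{1..n}, forall i, m i = s i + q i * step i) (in_cone s m).
Proof.
apply: (iffP forallP) => [h|[q e] i]; last by rewrite e leq_addr addnC modnMDl eqxx.
exists [multinom (m i - s i) %/ step i | i < n] => i; rewrite mnmE.
have /andP[le /eqP e] := h i; rewrite divnK ?subnKC //.
by rewrite -eqn_mod_dvd // e.
Qed.

Lemma in_cone_refl s : in_cone s s.
Proof. by apply/forallP=> i; rewrite leqnn eqxx. Qed.

Lemma residue_cone m : in_cone (residue m) m.
Proof. by apply/forallP=> i; rewrite mnmE leq_mod modn_mod eqxx. Qed.

Lemma residue_id m : residue (residue m) = residue m.
Proof. by apply/mnmP=> i; rewrite !mnmE modn_mod. Qed.

Lemma in_cone_residue s m : in_cone s m -> residue m = residue s.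
Proof.
by move/forallP=> h; apply/mnmP=> i; rewrite !mnmE; case/andP: (h i) => _ /eqP.
Qed.

Lemma wdeg_residue m : exists c, w m = w (residue m) + c * M.
Proof.
exists (\sum_i m i %/ step i).
rewrite /w /wdeg big_distrl -big_split; apply: eq_bigr => i _ /=.
by rewrite mnmE -(stepM i) mulnA -mulnDl addnC -divn_eq.
Qed.

Lemma dvd_residue s t : residue s = residue t -> (M %| w s) = (M %| w t).
Proof.
have [c es] := wdeg_residue s; have [d et] := wdeg_residue t.
by move=> e; rewrite es et e !(addnC (w _)) !dvdn_addr ?dvdn_mull.
Qed.

(** Two translates are disjoint or meet in a translate: this closes finite
    unions under intersection with a translate and drives the
    inclusion-exclusion of [counting_poly_cones]. *)
Lemma in_cone_meet s t m :
  in_cone s m && in_cone t m = (residue s == residue t) && in_cone (mlcm s t) m.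
Proof.
apply/andP/andP => [[hs ht]|[/eqP/mnmP e /forallP h]].
  split; first by rewrite -(in_cone_residue hs) -(in_cone_residue ht).
  apply/forallP=> i; rewrite mnmE geq_max.
  have /andP[-> es] := forallP hs i; have /andP[-> et] := forallP ht i.
  by rewrite /maxn; case: ifP.
split; apply/forallP=> i; move: (h i) (e i); rewrite !mnmE geq_max.
  by case/andP=> /andP[-> _] /=; rewrite /maxn; case: ifP => // _ /eqP -> ->.
by case/andP=> /andP[_ ->] /=; rewrite /maxn; case: ifP => // _ /eqP -> ->.
Qed.

Lemma residue_mlcm s t : residue s = residue t -> residue (mlcm s t) = residue s.
Proof.
move/mnmP=> e; apply/mnmP=> i; move: (e i); rewrite !mnmE.
by rewrite /maxn; case: ifP.
Qed.

(** The degree bound makes the enumeration finite; it excludes nothing, as the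
    weights are positive ([mem_monomials]). *)
Definition monomials d : seq 'X_{1..n} :=
  [seq m <- [seq bmnm b | b <- enum {: 'X_{1..n < d.+1}}] | w m == d].

Lemma mem_monomials d m : (m \in monomials d) = (w m == d).
Proof.
rewrite mem_filter andb_idr // => /eqP wm.
have lt : mdeg m < d.+1 by rewrite ltnS -wm mdeg_le_wdeg.
by apply/mapP; exists (BMultinom lt); rewrite ?mem_enum.
Qed.

Lemma monomials_uniq d : uniq (monomials d).
Proof. by rewrite filter_uniq // map_inj_uniq ?enum_uniq //; apply: val_inj. Qed.

(** The points of s + N v in degree j correspond to the monomials of ordinary
    degree j - t in n variables, where t M is the weight of s. *)
Lemma count_in_cone s j : 0 < n -> M %| w s -> w s <= j * M ->
  count (in_cone s) (monomials (j * M)) = 'C(j - w s %/ M + n.-1, n.-1).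
Proof.
move=> n_gt0 /dvdnP[t ws]; rewrite ws leq_pmul2r // mulnK // => le_tj.
pose sb := [seq s2m u | u : (j - t).-tuple 'I_n <- enum (basis n (j - t))].
pose f (q : 'X_{1..n}) : 'X_{1..n} := [multinom s i + q i * step i | i < n].
have inj_f : injective f.
  move=> a b /mnmP e; apply/mnmP=> i; have /eqP := e i.
  by rewrite !mnmE eqn_add2l eqn_pmul2r ?step_gt0 // => /eqP.
have wf q : w (f q) = (t + mdeg q) * M.
  rewrite mulnDl -ws mdegE big_distrl /w /wdeg -big_split; apply: eq_bigr => i _ /=.
  by rewrite mnmE mulnDl -mulnA stepM.
rewrite -size_filter; have /perm_size <- : perm_eq (map f sb)
    [seq m <- monomials (j * M) | in_cone s m].
  apply: uniq_perm; first by rewrite map_inj_uniq ?uniq_basis.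
    exact/filter_uniq/monomials_uniq.
  move=> m; rewrite mem_filter mem_monomials; apply/mapP/andP.
    move=> [q]; rewrite -basis_cover => /eqP dq ->; split; last first.
      by rewrite wf dq subnKC.
    by apply/in_coneP; exists q => i; rewrite mnmE.
  move=> [/in_coneP[q eq]]; have -> : m = f q by apply/mnmP=> i; rewrite eq mnmE.
  rewrite wf eqn_pmul2r // => /eqP e; exists q => //.
  by rewrite -basis_cover -e addKn.
by rewrite size_map size_degree_monomials.
Qed.

Local Open Scope ring_scope.

(** The coefficient of degree n-1 is recorded because it is, up to (n-1)!, the
    multiplicity. *)
Definition counting_poly (U : pred 'X_{1..n}) (e : rat) :=
  exists2 P : {poly rat}, P`_n.-1 = e &
  exists j0, forall j, (j0 <= j)%N -> P.[j%:R] = (count U (monomials (j * M)))%:R.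

(** With no variables a translate is a single point, so the counting polynomial
    is zero. *)
Definition cone_lead : rat := if n is 0 then 0 else ((n.-1)`!%:R)^-1.

(** The product form shows that 'C(d + p, p) is a polynomial in d, of degree p
    with leading coefficient 1 / p!. *)
Lemma rising_prod d p : ('C(d + p, p) * p`! = \prod_(i < p) (d + i.+1))%N.
Proof.
have e : ((d + p)`! = \prod_(i < p) (d + i.+1) * d`!)%N.
  elim: p => [|p IH]; first by rewrite big_ord0 addn0 mul1n.
  by rewrite addnS factS IH big_ord_recr /=; lia.
apply/eqP; rewrite -(eqn_pmul2r (fact_gt0 d)) -e -mulnA.
by rewrite -{2}(addnK p d) bin_fact ?leq_addl.
Qed.

Lemma counting_poly_cone s : (M %| w s)%N -> counting_poly (in_cone s) cone_lead.
Proof.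
move=> dvd; rewrite /counting_poly /cone_lead; case: (posnP n) => [n0|n_gt0].
  exists 0; first by rewrite coef0 n0.
  exists 1%N => j j_gt0; rewrite horner0; apply/eqP; rewrite eq_sym pnatr_eq0.
  rewrite -leqn0 leqNgt -has_count; apply/hasPn => m.
  rewrite mem_monomials /w /wdeg big1 => [|i _]; last first.
    by have := ltn_ord i; rewrite [X in (_ < X)%N]n0.
  by rewrite eq_sym muln_eq0 -!leqn0 leqNgt j_gt0 leqNgt M_gt0.
have -> : (if n is 0 then 0 else ((n.-1)`!%:R)^-1) = ((n.-1)`!%:R)^-1 :> rat.
  by case: (n) n_gt0.
set p := n.-1; pose t := (w s %/ M)%N.
pose P : {poly rat} := \prod_(i <- enum 'I_p) ('X - (t%:R - (i.+1)%:R)%:P).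
exists ((p`!%:R)^-1 *: P).
  rewrite coefZ; suff -> : P`_p = 1 by rewrite mulr1.
  have /monicP := monic_prod_XsubC (enum 'I_p) xpredT (fun i => t%:R - (i.+1)%:R : rat).
  by rewrite lead_coefE size_prod_XsubC size_enum_ord.
exists t => j le_tj; rewrite hornerZ horner_prod count_in_cone //; last first.
  by rewrite -(divnK dvd) leq_mul2r le_tj orbT.
apply: (mulfI (_ : p`!%:R != 0)); first by rewrite pnatr_eq0 -lt0n fact_gt0.
rewrite mulrA divff ?mul1r; last by rewrite pnatr_eq0 -lt0n fact_gt0.
rewrite -natrM mulnC rising_prod natr_prod big_enum /=; apply: eq_bigr => i _.
by rewrite !hornerE natrD natrB // opprB addrA addrAC.
Qed.

(** Induction on the number of translates, by the formula
    |s u L| = |s| + |L| - |s n L|.  The intersection of the translate at s with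
    those of L is a union of at most [size L] translates, all in the class of
    s, and it is nonempty exactly when that class already occurs in L; so the
    coefficient counts each class once. *)
Lemma counting_poly_cones L : all (fun s => M %| w s)%N L ->
  counting_poly (cones L) (cone_lead * (size (undup (map residue L)))%:R).
Proof.
have [k] := ubnP (size L); elim: k L => // k IH [|s L] /= szL.
  move=> _; exists 0; first by rewrite coef0 mulr0.
  by exists 0%N => j _; rewrite horner0 count_pred0.
case/andP=> dvd_s dvd_L.
have [P1 c1 [j1 h1]] := counting_poly_cone dvd_s.
have [P2 c2 [j2 h2]] := IH L szL dvd_L.
pose L' := [seq mlcm s t | t <- L & residue s == residue t].
have dvd_L' : all (fun s => M %| w s)%N L'.
  apply/allP=> u /mapP[t]; rewrite mem_filter => /andP[/eqP e tL] ->.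
  rewrite (dvd_residue (residue_mlcm e)).
  exact: dvd_s.
have [|P3 c3 [j3 h3]] := IH L' _ dvd_L'.
  by rewrite size_map size_filter (leq_ltn_trans (count_size _ _)).
exists (P1 + P2 - P3).
  rewrite coefB coefD c1 c2 c3 /=.
  have -> : size (undup (map residue L')) = (residue s \in map residue L).
    rewrite (@size_undup_constant _ (residue s)); last first.
      apply/allP=> r /mapP[u /mapP[t]]; rewrite mem_filter => /andP[/eqP e _] -> ->.
      by rewrite /= residue_mlcm.
    congr nat_of_bool; apply/idP/mapP => [|[t tL e]].
      case E : L' => [|u L0] // _; have : u \in L' by rewrite E mem_head.
      by case/mapP=> t; rewrite mem_filter => /andP[/eqP e tL] _; exists t.
    apply/eqP=> /(congr1 (fun L => residue (mlcm s t) \in L)); rewrite in_nil.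
    by rewrite map_f // map_f // mem_filter e eqxx.
  by case: ifP => _ /=; rewrite ?mulr0 ?mulr1 ?subr0 ?[(_.+1)%:R]mulrSr; ring.
exists (maxn j1 (maxn j2 j3)) => j; rewrite !geq_max => /and3P[le1 le2 le3].
rewrite !hornerE h1 // h2 // h3 //; apply/eqP; rewrite subr_eq -!natrD eqr_nat.
rewrite -count_predUI; apply/eqP; congr (_ + _)%N.
apply: eq_count => m /=; rewrite /cones /L' has_map.
elim: (L) => [|t L0 IH0] /=; rewrite ?andbF // andb_orr IH0 in_cone_meet.
by case: (residue s == residue t).
Qed.

Local Close Scope ring_scope.

Lemma in_cone_trans s t m : in_cone s t -> in_cone t m -> in_cone s m.
Proof.
move=> /in_coneP[q eq] /in_coneP[r er]; apply/in_coneP; exists (q + r)%MM => i.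
by rewrite er eq mnmDE mulnDl addnA.
Qed.

Lemma in_coneD u s m : in_cone s m -> in_cone (u + s)%MM (u + m)%MM.
Proof.
move=> /in_coneP[q eq]; apply/in_coneP; exists q => i.
by rewrite !mnmDE eq addnA.
Qed.

Lemma in_coneMn s u : in_cone s (u *+ M + s)%MM.
Proof.
apply/in_coneP; exists [multinom u i * l i | i < n] => i.
by rewrite mnmDE mulmnE mnmE addnC -mulnA [l i * _]mulnC stepM.
Qed.

(** * Both exponent sets are finite unions of translates *)

(** The sums [\sum_g c_g g] with all [c_g < M].  Up to translation by N v they
    give the whole monoid generated by L, because M g lies in N v for every
    exponent g ([in_coneMn]). *)
Fixpoint combinations L : seq 'X_{1..n} :=
  if L is g :: L' then [seq (g *+ c + s)%MM | c <- iota 0 M, s <- combinations L']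
  else [:: 0%MM].

Lemma combinations_cons g L c s : c < M ->
  s \in combinations L -> (g *+ c + s)%MM \in combinations (g :: L).
Proof. by move=> cM sL /=; apply: allpairs_f; rewrite ?mem_iota. Qed.

Lemma combinations_tail g L s :
  s \in combinations L -> s \in combinations (g :: L).
Proof. by move/(combinations_cons g M_gt0); rewrite mulm0n add0m. Qed.

Lemma combinations0 L : 0%MM \in combinations L.
Proof.
by elim: L => [|g L IH]; [rewrite mem_head | apply: combinations_tail].
Qed.

(** Raising the coefficient of g from M - 1 to M produces M g, which is absorbed
    by N v; so the coefficient restarts from 0. *)
Lemma combinations_absorb L g s :
  g \in L -> s \in combinations L -> cones (combinations L) (g + s)%MM.
Proof.
elim: L s => // h L IH s; rewrite inE => gL /= /allpairsP[[c s'] /= [hc hs' ->]].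
rewrite mem_iota /= add0n in hc; case/predU1P: gL => [->|gL].
  move: hc; rewrite leq_eqVlt => /predU1P[cM|lt_cM].
    apply/hasP; exists s'; first exact: combinations_tail.
    by rewrite addmA -mulmS cM; apply: in_coneMn.
  apply/hasP; exists (h + (h *+ c + s'))%MM; last exact: in_cone_refl.
  by rewrite addmA -mulmS; apply: combinations_cons.
have /hasP[t tL ht] := IH s' gL hs'.
apply/hasP; exists (h *+ c + t)%MM.
  exact: combinations_cons.
by rewrite addmA [(g + _)%MM]addmC -addmA; apply: in_coneD.
Qed.

Definition generators := combinations (monomials M).

Lemma weightM_monoidMn S a c : weightM_monoid S -> S a -> S (a *+ c)%MM.
Proof.
case=> S0 SD _ Sa; elim: c => [|c IH]; last by rewrite mulmS; apply: SD.
by rewrite mulm0n.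
Qed.

(** Together with [generators_weightM_monoid]: the union of the translates at
    the generators is the monoid generated by the exponents of weight M. *)
Lemma generators_min S m : weightM_monoid S -> cones generators m -> S m.
Proof.
move=> monS; have [S0 SD SM] := monS; case/hasP=> s sG /in_coneP[q mE].
have -> : m = (s + \sum_(i < n) U_(i) *+ (step i * q i))%MM.
  apply/mnmP=> k; rewrite mE mnmDE mnm_sumE (bigD1 k) //= big1 => [|i ne].
    by rewrite mulmnE mnm1E eqxx mul1n addn0 mulnC.
  by rewrite mulmnE mnm1E (negbTE ne).
apply: (SD); last first.
  apply: big_ind => [||i _]; [exact: S0 | exact: (SD) |].
  have -> : (U_(i) *+ (step i * q i) = U_(i) *+ step i *+ q i)%MM.
    by apply/mnmP=> k; rewrite !mulmnE mulnA.
  by apply: (weightM_monoidMn _ monS); apply: SM; rewrite wdegMn wdegU mulnC stepM.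
have SG g : g \in monomials M -> S g by rewrite mem_monomials => /eqP/SM.
move: SG sG; rewrite /generators; elim: (monomials M) s {mE} => [|g G IH] s SG /=.
  by rewrite inE => /eqP ->.
case/allpairsP=> [[c t] /= [_ tG ->]]; apply: (SD).
  by apply: (weightM_monoidMn _ monS); apply: SG; rewrite mem_head.
by apply: IH => // h hG; apply: SG; rewrite inE hG orbT.
Qed.

Lemma generators_weightM_monoid : weightM_monoid (cones generators).
Proof.
have cone0 : cones generators 0%MM.
  by apply/hasP; exists 0%MM; rewrite ?combinations0 ?in_cone_refl.
have absorb g m : w g = M -> cones generators m -> cones generators (g + m)%MM.
  move=> /eqP wg /hasP[s sG sm]; have gG : g \in monomials M by rewrite mem_monomials.
  have /hasP[t tG ht] := combinations_absorb gG sG.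
  by apply/hasP; exists t => //; apply: in_cone_trans ht _; apply: in_coneD.
split=> // [a b ha|a wa]; last by rewrite -[a]addm0; apply: absorb.
(* closure under sums: the exponents a whose translation preserves the union
   form a monoid containing the weight M, so minimality applies to them *)
move: b; pose T a := forall b, cones generators b -> cones generators (a + b)%MM.
apply: (@generators_min T) ha; split=> [b|c d hc hd b|g wg b].
- by rewrite add0m.
- by move=> /hd/hc; rewrite addmA.
- exact: absorb.
Qed.

Lemma dvdn_weightM_monoid : weightM_monoid (fun m => M %| w m).
Proof.
split=> [|a b da db|a ->] //; first by rewrite /w wdeg0 dvdn0.
by rewrite /w wdegD dvdn_add.
Qed.

(** The degree bound n M leaves room for the residues, which already generate:
    each coordinate of a residue is less than M. *)
Definition veronese_generators : seq 'X_{1..n} :=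
  [seq m <- [seq bmnm b | b <- enum {: 'X_{1..n < (n * M).+1}}] | M %| w m].

Lemma mem_cones_veronese m : cones veronese_generators m = (M %| w m).
Proof.
apply/hasP/idP => [[s]|dvd].
  by rewrite mem_filter => /andP[ds _] /in_cone_residue/dvd_residue ->.
exists (residue m); last exact: residue_cone.
rewrite mem_filter (dvd_residue (residue_id m)) dvd /=.
have lt : mdeg (residue m) < (n * M).+1.
  rewrite ltnS mdegE -[n in n * M]card_ord -sum_nat_const leq_sum // => i _.
  by rewrite mnmE (leq_trans (ltnW (ltn_pmod _ (step_gt0 i)))) // dvdn_leq // step_dvd.
by apply/mapP; exists (BMultinom lt); rewrite ?mem_enum.
Qed.

(** Birationality enters here.  Let S be the monoid generated by the exponents
    of weight M.  For t of weight divisible by M choose b with b and t + b in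
    S; then t + M b is in S, and it is congruent to t. *)
Lemma residue_generators :
  map residue generators =i map residue veronese_generators.
Proof.
move=> r; apply/mapP/mapP => [[s sG ->]|[t tB ->]].
  have : cones generators s by apply/hasP; exists s; rewrite ?in_cone_refl.
  move/(generators_min dvdn_weightM_monoid); rewrite -mem_cones_veronese.
  by case/hasP=> t tB /in_cone_residue ->; exists t.
have : cones veronese_generators t by apply/hasP; exists t; rewrite ?in_cone_refl.
rewrite mem_cones_veronese => /(exists_denominator generators_weightM_monoid)[b Sb Stb].
have : cones generators (b *+ M + t)%MM.
  rewrite -(prednK M_gt0) mulmS [(b + _)%MM]addmC -addmA [(b + t)%MM]addmC.
  have [_ SD _] := generators_weightM_monoid; apply: SD => //.
  exact: (weightM_monoidMn _ generators_weightM_monoid).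
case/hasP=> s sG hs; exists s => //.
by rewrite -(in_cone_residue hs) (in_cone_residue (in_coneMn t b)).
Qed.

Lemma counting_poly_generators :
  exists2 e, counting_poly (cones generators) e
           & counting_poly (fun m => M %| w m) e.
Proof.
exists (cone_lead * (size (undup (map residue generators)))%:R)%R.
  apply: counting_poly_cones; apply/allP=> s sG.
  apply: (generators_min dvdn_weightM_monoid).
  by apply/hasP; exists s; rewrite ?in_cone_refl.
have -> : size (undup (map residue generators))
        = size (undup (map residue veronese_generators)).
  apply/perm_size/uniq_perm; rewrite ?undup_uniq // => r.
  by rewrite !mem_undup residue_generators.
have [|P cP [j0 hP]] := @counting_poly_cones veronese_generators.
  by apply/allP=> s; rewrite mem_filter => /andP[].
exists P => //; exists j0 => j /hP ->; congr (_%:R)%R.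
exact/eq_count/mem_cones_veronese.
Qed.

End VeroneseMonoid.

(** * Spaces spanned by monomials *)

Section MonomialSpaces.
Variables (k : fieldType) (n : nat).
Implicit Types (p q : {mpoly k[n]}) (U : pred 'X_{1..n}).
Local Open Scope ring_scope.

Lemma has_dim_monomials (s : seq 'X_{1..n}) (V : {mpoly k[n]} -> Prop) :
  uniq s -> (forall p, V p <-> {subset msupp p <= s}) -> has_dim V (size s).
Proof.
move=> uniq_s VE; exists (fun i => 'X_[nth 0%MM s i]).
have coeff (c : 'I_(size s) -> k) (j : 'I_(size s)) :
    (\sum_i c i *: 'X_[nth 0%MM s i])@_(nth 0%MM s j) = c j.
  rewrite raddf_sum (bigD1 j) //= mcoeffZ mcoeffX eqxx mulr1 big1 ?addr0 // => i ne.
  by rewrite mcoeffZ mcoeffX nth_uniq // (inj_eq val_inj) (negbTE ne) mulr0.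
have coeff0 (c : 'I_(size s) -> k) m :
    m \notin s -> (\sum_i c i *: 'X_[nth 0%MM s i])@_m = 0.
  move=> ms; rewrite raddf_sum big1 // => i _ /=; rewrite mcoeffZ mcoeffX.
  case: eqP => [e|]; last by rewrite mulr0.
  by rewrite -e mem_nth in ms.
split=> [c /(congr1 (mcoeff _)) c0 i|p]; first by rewrite -(coeff c i) c0 mcoeff0.
rewrite VE; split=> [sub|[c ->] m].
  exists (fun i => p@_(nth 0%MM s i)); apply/mpolyP=> m.
  have [/(nthP 0%MM)[i lt <-]|ms] := boolP (m \in s).
    by rewrite (coeff _ (Ordinal lt)).
  by rewrite coeff0 //; apply: memN_msupp_eq0; apply: contra (sub m) ms.
by rewrite mcoeff_msupp; apply: contraR => /coeff0 ->.
Qed.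

Lemma msupp_mulX p m u : u \in msupp (p * 'X_[m]) ->
  exists2 v, v \in msupp p & u = (v + m)%MM.
Proof.
move/msuppM_le/allpairsP=> [[v y] /= [vp]]; rewrite msuppX inE => /eqP -> ->.
by exists v.
Qed.

Lemma has_mult_monomials (l : 'I_n -> nat) M U (A : {mpoly k[n]} -> Prop) e :
    (forall i, 0 < l i)%N ->
    (forall j p, rescaled l M A j p <->
       {subset msupp p <= [pred m | U m & wdeg l m == j * M]%N}) ->
  counting_poly l M U e -> has_mult n (rescaled l M A) ((n.-1)`!%:R * e).
Proof.
move=> l_gt0 AE [P <- [j0 hP]]; exists P => //; exists j0 => j le_j.
exists (size [seq m <- monomials l (j * M) | U m]); last by rewrite size_filter hP.
apply: has_dim_monomials; first exact/filter_uniq/monomials_uniq.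
by move=> p; rewrite AE; split=> sub m /sub; rewrite mem_filter mem_monomials.
Qed.

End MonomialSpaces.

(** * The Veronese ring and its subalgebra *)

Section VeroneseAlgebra.
Variables (k : fieldType) (n : nat) (l : 'I_n -> nat) (M : nat).
Hypotheses (l_gt0 : forall i, 0 < l i) (M_gt0 : 0 < M).
Hypothesis l_dvd_M : forall i, l i %| M.
Implicit Types (p q : {mpoly k[n]}).
Local Open Scope ring_scope.

Let kRM := gen_subalg (gr_comp (k := k) l M).
Let RM := veronese (k := k) l M.
Let S := cones l M (generators l M).

Lemma subalg_sum (I : eqType) (r : seq I) (F : I -> {mpoly k[n]}) (c : I -> k) :
  (forall i, i \in r -> kRM (F i)) -> kRM (\sum_(i <- r) c i *: F i).
Proof.
move=> AF; rewrite big_seq; apply: big_ind => [|p q|i /AF AFi].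
- by rewrite -[0](scale0r 1); apply: gen_scal.
- exact: gen_add.
by rewrite -[F i]mul1r scalerAl; apply: gen_mul => //; apply: gen_scal.
Qed.

(** With [generators_min], this puts x^m in k[R_M] for every m in S. *)
Lemma subalg_monomials : weightM_monoid l M (fun m => kRM 'X_[m]).
Proof.
split=> [|a b Aa Ab|a wa].
- by rewrite mpolyX0 -[1]scale1r; apply: gen_scal.
- by rewrite mpolyXD; apply: gen_mul.
by apply: gen_incl; rewrite /gr_comp dhomogX /= wa.
Qed.

Lemma subalgP p : kRM p <-> {subset msupp p <= S}.
Proof.
have [S0 SD SM] := generators_weightM_monoid l_gt0 M_gt0 l_dvd_M.
split=> [|sub]; last first.
  rewrite [p]mpolyE; apply: subalg_sum => m /sub.
  exact: generators_min subalg_monomials.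
elim=> {p} [p /dhomogP hp m mp|c m|p q _ IHp _ IHq m|p q _ IHp _ IHq m].
- exact/SM/hp.
- by move/msuppZ_le; rewrite msupp1 inE => /eqP ->.
- by move/msuppD_le; rewrite mem_cat => /orP[/IHp|/IHq].
by move/msuppM_le/allpairsP=> [[a b] /= [/IHp Sa /IHq Sb ->]]; apply: SD.
Qed.

(** Conversely to the definition, a polynomial supported in weights divisible
    by M is the sum of its components of weight j M; the largest weight in its
    support bounds j, as M > 0. *)
Lemma veroneseP p : RM p <-> {subset msupp p <= (fun m => M %| wdeg l m)%N}.
Proof.
split=> [[N [f [hf ->]]] m|sub].
  move/msupp_sum_le/flattenP=> [_ /mapP[j _ ->]] /(dhomogP _ _ _ (hf j)) wm.
  by rewrite -topredE /= wm dvdn_mull.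
pose part j := \sum_(m <- msupp p | (wdeg l m == j * M)%N) p@_m *: 'X_[m].
exists (\max_(m <- msupp p) wdeg l m)%N.+1, part; split=> [j|].
  rewrite /gr_comp /part; apply: rpred_sum => m /eqP wm; apply: dhomogZ.
  by rewrite dhomogX /= wm.
rewrite (exchange_big_dep predT) //= [LHS]mpolyE big_seq [RHS]big_seq.
apply: eq_bigr => m mp; have /dvdnP[t wm] : (M %| wdeg l m)%N := sub m mp.
have lt : (t < (\max_(m <- msupp p) wdeg l m).+1)%N.
  rewrite ltnS (leq_trans _ (leq_bigmax_seq _ mp _)) // wm.
  exact: leq_pmulr.
rewrite (bigD1 (Ordinal lt)) /=; last by rewrite wm.
rewrite big1 ?addr0 // => j /andP[]; rewrite wm eqn_pmul2r // => /eqP tj /eqP[].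
by apply: val_inj; rewrite /= tj.
Qed.

Lemma subalg_veronese p : kRM p -> RM p.
Proof.
move/subalgP=> sub; apply/veroneseP => m /sub Sm.
exact: (generators_min l_gt0 l_dvd_M (dvdn_weightM_monoid l M) Sm).
Qed.

(** A fraction a / b over R^(M) is rewritten by multiplying a and b by one
    monomial that brings all the monomials of both into k[R_M]. *)
Lemma subalg_birational : birational_ext kRM RM.
Proof.
split=> [|x]; first exact: subalg_veronese.
split=> [[a [b [Aa Ab b0 ->]]]|[a [b [/veroneseP Ba /veroneseP Bb b0 ->]]]].
  by exists a, b; split=> //; apply: subalg_veronese.
have monS := generators_weightM_monoid l_gt0 M_gt0 l_dvd_M.
have [|d _ hd] := common_denominator l_gt0 M_gt0 l_dvd_M monS (L := msupp a ++ msupp b).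
  by apply/allP=> m; rewrite mem_cat => /orP[/Ba|/Bb].
have Xd0 : 'X_[d] != 0 :> {mpoly k[n]} by rewrite -msupp_eq0 msuppX.
exists (a * 'X_[d]), (b * 'X_[d]); split.
- by apply/subalgP=> _ /msupp_mulX[v va ->]; apply: hd; rewrite mem_cat va.
- by apply/subalgP=> _ /msupp_mulX[v vb ->]; apply: hd; rewrite mem_cat vb orbT.
- by rewrite mulf_neq0.
by rewrite !rmorphM /= -mulf_div divff ?mulr1 // tofrac_eq0.
Qed.

Lemma subalg_mult_eq : exists2 e : rat,
  has_mult n (rescaled l M kRM) e & has_mult n (rescaled l M RM) e.
Proof.
have [e hS hB] := counting_poly_generators l_gt0 M_gt0 l_dvd_M.
have rescaledP (A : {mpoly k[n]} -> Prop) (U : pred 'X_{1..n}) :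
    (forall p, A p <-> {subset msupp p <= U}) -> forall j p,
    rescaled l M A j p <-> {subset msupp p <= [pred m | U m & wdeg l m == j * M]%N}.
  move=> AE j p; split=> [[/AE sub /dhomogP hp] m mp|sub].
    by rewrite inE; apply/andP; split; [apply: sub | apply/eqP/hp].
  split; first by apply/AE => m /sub /andP[].
  by apply/dhomogP => m /sub /andP[_ /eqP].
exists ((n.-1)`!%:R * e); apply: has_mult_monomials => //.
- exact: (rescaledP _ S subalgP).
- exact: hS.
- exact: (rescaledP _ _ veroneseP).
exact: hB.
Qed.

End VeroneseAlgebra.

Theorem corollary5p5 (k : fieldType) (n : nat) (l : 'I_n -> nat) (M : nat)
    (l_gt0 : forall i, 0 < l i)
    (M_gt0 : 0 < M) (l_dvd_M : forall i, l i %| M) :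
  let kRM := gen_subalg (gr_comp (k := k) l M) in
  let RM := veronese (k := k) l M in
  birational_ext kRM RM /\
  (exists2 e : rat, has_mult n (rescaled l M kRM) e
                  & has_mult n (rescaled l M RM) e).
Proof.
by move=> kRM RM; split; [apply: subalg_birational | apply: subalg_mult_eq].
Qed.
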